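(* Let $q$ be a prime, let $d=\pi(q-1)$ be the number of primes less than $q$, and let $p_1<p_2<\dots<p_d$ be these primes. For $n\in\{1,2,\dots,q-1\}$ write $n=\prod_{i=1}^d p_i^{\mu_i(n)}$ and define the linear form $\mathscr{L}_n:\mathbb{F}_q^d\to\mathbb{F}_q$ by $\mathscr{L}_n(\mathbf{v})=\sum_{i=1}^d \mu_i(n)v_i$ for $\mathbf{v}=(v_1,\dots,v_d)$. For a fixed $x_0\in\mathbb{F}_q^\times$ let $$N_q(x_0)=\#\{\mathbf{v}\in\mathbb{F}_q^d:\ \mathscr{L}_n(\mathbf{v})\neq x_0 \text{ for all } n\in\{1,2,\dots,q-1\}\},$$ and put $c(q)=N_q(x_0)/q^d$. Then, as $q\to\infty$, $$c(q)=\frac{1}{e}+O\!\left(\frac{1}{\log_2 q}\right).$$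
   Context: $\log x:=\max\{\ln x,2\}$ and $\log_k x:=\log(\log_{k-1}x)$ for $k\ge 2$. $\pi(x)$ is the number of primes $\le x$. *)

(* Defs.v *)
From mathcomp Require Import all_boot all_order all_algebra.
From Stdlib Require Import Reals.
Set Implicit Arguments. Unset Strict Implicit. Unset Printing Implicit Defensive.
Import GRing.Theory.

Definition primes_below (q : nat) : seq nat := [seq p <- iota 0 q | prime p].

Definition dim_q (q : nat) : nat := size (primes_below q).

Section Lf.
Local Open Scope ring_scope.
Definition Lform (q : nat) (n : nat) (v : 'rV['F_q]_(dim_q q)) : 'F_q :=
  (\sum_(i < dim_q q) (GRing.natmul (1 : 'F_q) (logn (nth 0%N (primes_below q) i) n)) * v ord0 i).
End Lf.

Definition Ncount (q : nat) (x0 : 'F_q) : nat :=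
  #|[set v : 'rV['F_q]_(dim_q q) |
      [forall n : 'I_q, (0 < n)%N ==> (Lform n v != x0)%B]]|.

Definition logR (x : R) : R := Rmax (ln x) 2.
Definition log2R (x : R) : R := logR (logR x).

Definition cq (q : nat) (x0 : 'F_q) : R :=
  (INR (Ncount x0) / (INR q ^ dim_q q))%R.

(* Main.v *)
(** Group the integers [1 < n < q] into layers by their largest prime factor [k].
    For [n] in layer [k] the form [L_n] involves the coordinate of [k], whereas
    the forms of the lower layers do not; hence, given that all lower layers
    avoid [x0], each event [L_n = x0] still has probability exactly [1/q].  Two
    distinct such events occur together with probability at most [1/q^2], since
    proportional forms can share the value [x0 != 0] only if they are equal.
    If layer [k] has [A] elements, Bonferroni multiplies the probability of
    avoidance by [1 - A/q], up to an error [(A/q)^2].  The sizes of the layers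
    add up to [q - 2], and each is at most [q / y] for [y] about [log log q]: for
    [k > y] by counting multiples of [k], for [k <= y] by counting smooth numbers.
    So the product is [1/e] up to [O(1/y)]. *)

From Stdlib Require Import Reals Lra.
From mathcomp Require Import all_boot all_order all_algebra.
From mathcomp Require Import zify.
Require Import Defs.
Set Implicit Arguments.
Unset Strict Implicit.
Unset Printing Implicit Defensive.
Import GRing.Theory.

(** * Equidistribution of linear forms over a finite field *)

Section LinearForms.
Local Open Scope ring_scope.
Variables (F : finFieldType) (d : nat).
Implicit Types (a b : 'I_d -> F) (v : 'rV[F]_d) (E : {set 'rV[F]_d}).

Definition linear_form a v : F := \sum_i a i * v ord0 i.

Lemma linear_form_translate a v j t :
  linear_form a (v + t *: delta_mx ord0 j) = linear_form a v + t * a j.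
Proof.
rewrite /linear_form; under eq_bigr => i _ do rewrite !mxE eqxx mulrDr.
rewrite big_split /=; congr (_ + _).
rewrite (bigD1 j) //= eqxx mulr1 mulrC big1 ?addr0 // => i /negbTE ->.
by rewrite !mulr0.
Qed.

(** Translating coordinate [j] by [(z - y) / a j] carries the fibre over [y] injectively into the
    fibre over [z]. Hence all [#|F|] fibres in [E] have the same size. *)
Lemma card_linear_form_fiber E a j x :
    a j != 0 ->
    (forall v t, v \in E -> v + t *: delta_mx ord0 j \in E) ->
  (#|[set v in E | linear_form a v == x]| * #|F|)%N = #|E|.
Proof.
move=> aj0 Einv.
have fiber_le (y z : F) : (#|[set v in E | linear_form a v == y]|
                     <= #|[set v in E | linear_form a v == z]|)%N.
  set tr := fun v => v + ((z - y) / a j) *: delta_mx ord0 j.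
  have tr_inj : injective tr by move=> u w /addIr.
  rewrite -(card_imset _ tr_inj); apply/subset_leq_card/subsetP => w /imsetP[v].
  rewrite inE => /andP[vE /eqP av] ->; rewrite inE Einv //=.
  by rewrite linear_form_translate av divfK // addrC subrK.
have fiber_eq y : #|[set v in E | linear_form a v == y]|
                  = #|[set v in E | linear_form a v == x]|.
  by apply/eqP; rewrite eqn_leq !fiber_le.
rewrite -[RHS]sum1_card (partition_big (linear_form a) predT) //=.
under eq_bigr => y _.
  rewrite sum1dep_card fiber_eq; over.
by rewrite sum_nat_const mulnC.
Qed.

(* Either the two forms are independent, or they are proportional; in the
   latter case a common value [x != 0] forces the ratio to be [1]. *)
Lemma card_linear_form_fiber2 a b j x :
    x != 0 -> a j != 0 -> b j != 0 -> (exists i, a i != b i) ->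
  (#|[set v | (linear_form a v == x) && (linear_form b v == x)]| * #|F| ^ 2
   <= #|{: 'rV[F]_d}|)%N.
Proof.
move=> x0 aj0 bj0 [i0 abi0].
(* This combination eliminates coordinate [j]. If it is nonzero, a common value [x] puts [v] in a
   fibre [G] of [g], of density [1/#|F|]; since [G] is stable along coordinate [j], the form [a]
   then cuts out a further factor [1/#|F|]. *)
pose g i := b j * a i - a j * b i.
have gE v : linear_form g v = b j * linear_form a v - a j * linear_form b v.
  rewrite /linear_form !mulr_sumr -sumrB; apply: eq_bigr => i _.
  by rewrite /g mulrBl !mulrA.
have gj : g j = 0 by rewrite /g mulrC subrr.
have [/existsP[i gi] | /existsPn g0] := boolP [exists i, g i != 0].
  pose G := [set v | linear_form g v == (b j - a j) * x].
  have cardG : (#|G| * #|F|)%N = #|{: 'rV[F]_d}|.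
    rewrite -[RHS]cardsT -(card_linear_form_fiber ((b j - a j) * x) gi (E := setT)).
      by congr (_ * _)%N; apply: eq_card => v; rewrite !inE.
    by move=> v t; rewrite !inE.
  rewrite -cardG expnS expn1 mulnA leq_mul2r; apply/orP; right.
  rewrite -(card_linear_form_fiber x aj0 (E := G)); last first.
    by move=> v t; rewrite !inE linear_form_translate gj mulr0 addr0.
  rewrite leq_mul2r; apply/orP; right; apply/subset_leq_card/subsetP => v.
  rewrite !inE => /andP[/eqP av /eqP bv].
  by rewrite gE av bv eqxx mulrBl eqxx.
rewrite (_ : [set v | _] = set0) ?cards0 //; apply/setP => v; rewrite !inE.
apply/negbTE/negP => /andP[/eqP av /eqP bv].
have g_eq0 i : g i = 0 by have /negPn/eqP := g0 i.
have /eqP : linear_form g v = 0.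
  by rewrite /linear_form big1 // => i _; rewrite g_eq0 mul0r.
rewrite gE av bv -mulrBl mulf_eq0 (negbTE x0) orbF subr_eq0 => /eqP baj.
move/eqP: (g_eq0 i0); rewrite /g baj -mulrBr mulf_eq0 (negbTE aj0) subr_eq0 /=.
by rewrite (negbTE abi0).
Qed.

End LinearForms.

(** * Bonferroni inequalities, by counting how many events contain each point *)

Section Bonferroni.
Variables (T I : finType) (S : {set T}) (A : {set I}) (E : I -> {set T}).

Let U := [set v in S | [forall n in A, v \notin E n]].

Let hits v := #|[set n in A | v \in E n]|.

Let sum_card_hits (B : {set T}) :
  \sum_(n in A) #|B :&: E n| = \sum_(v in B) hits v.
Proof.
under eq_bigr => n _ do rewrite -sum1_card.
rewrite (exchange_big_dep (mem B)) /=; last by move=> n v _; rewrite inE => /andP[].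
apply: eq_bigr => v vB; rewrite /hits -sum1_card; apply: eq_bigl => n.
by rewrite !inE vB.
Qed.

Let avoidE v : [forall n in A, v \notin E n] = (hits v == 0).
Proof.
apply/forall_inP/eqP => [vA | /eqP].
  apply/eqP; rewrite cards_eq0; apply/eqP/setP => n; rewrite !inE.
  by case: (boolP (n \in A)) => // /vA /negbTE.
rewrite cards_eq0 => /eqP/setP h0 n nA.
by have := h0 n; rewrite !inE nA /= => ->.
Qed.

Let card_avoid : #|U| = \sum_(v in S) (hits v == 0).
Proof.
rewrite -sum1_card [RHS](bigID (fun v => hits v == 0)) /=.
rewrite [X in _ = _ + X]big1 ?addn0; last by move=> v /andP[_ /negbTE ->].
rewrite (eq_bigl (fun v => (v \in S) && (hits v == 0))).
  by apply: eq_bigr => v /andP[_ ->].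
by move=> v; rewrite !inE avoidE.
Qed.

Lemma union_bound : #|S| <= #|U| + \sum_(n in A) #|S :&: E n|.
Proof.
rewrite sum_card_hits card_avoid -big_split -sum1_card leq_sum //= => v _.
by case: (hits v).
Qed.

(** At a point lying in [h] events this is [[h = 0] + h <= 1 + h(h - 1)]. The pairs are ordered and
    counted on the whole space rather than on [S], which is crude but enough for an error quadratic
    in the size of a layer. *)
Lemma bonferroni_bound :
  #|U| + \sum_(n in A) #|S :&: E n|
    <= #|S| + \sum_(n in A) \sum_(m in A | m != n) #|E n :&: E m|.
Proof.
have -> : \sum_(n in A) \sum_(m in A | m != n) #|E n :&: E m|
          = \sum_v hits v * (hits v).-1.
  transitivity (\sum_(n in A) \sum_(v in E n) (hits v).-1).
    apply: eq_bigr => n nA; under eq_bigr => m _ do rewrite -sum1_card.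
    rewrite (exchange_big_dep (mem (E n))) /=; last first.
      by move=> m v _; rewrite inE => /andP[].
    apply: eq_bigr => v vE; rewrite /hits (cardsD1 n) !inE nA vE /=.
    rewrite -sum1_card; apply: eq_bigl => m; rewrite !inE vE /=.
    by rewrite andbA [_ && (m \in A)]andbC.
  rewrite (exchange_big_dep predT) //=; apply: eq_bigr => v _.
  rewrite sum_nat_cond_const; congr (_ * _).
rewrite sum_card_hits card_avoid -big_split -sum1_card /=.
rewrite [X in _ <= _ + X](bigID (mem S)) /= addnA -big_split /=.
apply: leq_trans (leq_addr _ _); apply: leq_sum => v _.
by case: (hits v) => [|[|h]] //=; nia.
Qed.

End Bonferroni.

(** * Layers by largest prime factor, and bounds on their sizes *)

Lemma logn_max_pdiv_gt0 n : 1 < n -> 0 < logn (max_pdiv n) n.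
Proof. by rewrite logn_gt0 -pi_max_pdiv. Qed.

Lemma logn_gt_max_pdiv p n : max_pdiv n < p -> logn p n = 0.
Proof.
move=> ltp; apply/eqP; rewrite -leqn0 leqNgt logn_gt0; apply/negP.
by move/max_pdiv_max; rewrite leqNgt ltp.
Qed.

(** The exponent inequality behind the bound for small [k] in [card_layer_log]. It fails at [y = 5],
    whence the threshold 6 from here on. *)
Lemma square_le_exp2 y : 6 <= y -> y.+1 * y.+1 + y <= 2 ^ y.
Proof.
elim: y => // y IH; rewrite leq_eqVlt => /orP[/eqP<- // | y6].
by rewrite expnS; have := IH y6; nia.
Qed.

Section Layers.
Variable q : nat.

Definition smooth_below k := [set n : 'I_q | (1 < n) && (max_pdiv n < k)].
Definition layer k := [set n : 'I_q | (1 < n) && (max_pdiv n == k)].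

Lemma card_smooth_belowS k : #|smooth_below k.+1| = #|smooth_below k| + #|layer k|.
Proof.
rewrite -cardsUI [X in _ + #|pred_of_set X|](_ : _ = set0).
  rewrite cards0 addn0; apply: eq_card => n; rewrite !inE -andb_orr.
  by rewrite [max_pdiv n < k.+1]ltnS (leq_eqVlt (max_pdiv n)) orbC.
by apply/setP => n; rewrite !inE; case: (ltngtP (max_pdiv n) k); rewrite ?andbF.
Qed.

Lemma card_smooth_below_full : #|smooth_below q| = q - 2.
Proof.
have -> : smooth_below q = ~: [set n : 'I_q | n < 2].
  apply/setP => n; rewrite !inE -leqNgt; case: ltnP => //= n1.
  by rewrite (leq_ltn_trans _ (ltn_ord n)) // max_pdiv_leq // ltnW.
have := cardsC [set n : 'I_q | n < 2]; rewrite card_ord.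
suff -> : #|[set n : 'I_q | n < 2]| = minn 2 q by lia.
rewrite cardsE cardE size_filter /=.
have -> : count (fun n : 'I_q => n < 2) (Finite.enum 'I_q)
          = count (fun n => n < 2) (iota 0 q).
  by rewrite -val_enum_ord count_map -enumT.
case: q => [|[|r]] //=; rewrite (@eq_in_count _ _ pred0) ?count_pred0; first by lia.
by move=> n; rewrite mem_iota /=; lia.
Qed.

Lemma card_layer_mul k : #|layer k| * k <= q.
Proof.
have [-> | [n0]] := set_0Vmem (layer k); first by rewrite cards0.
rewrite inE => /andP[n01 /eqP n0k].
have k_gt0 : 0 < k by rewrite -n0k.
have kq : 0 < q %/ k.
  rewrite divn_gt0 // ltnW // (leq_ltn_trans _ (ltn_ord n0)) // -n0k.
  by rewrite max_pdiv_leq // ltnW.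
(* The quotients [n %/ k] run from 1 to [q %/ k]; they are shifted down by one because ordinals
   start at 0. *)
pose f (n : 'I_q) : 'I_(q %/ k).-1.+1 := inord (n %/ k).-1.
rewrite -leq_divRL //; apply: leq_trans (_ : #|'I_(q %/ k).-1.+1| <= _); last first.
  by rewrite card_ord prednK.
apply: (@leq_card_in _ _ f) => n m; rewrite !inE.
have quo_spec (l : 'I_q) : (1 < l) && (max_pdiv l == k) ->
    l = l %/ k * k :> nat /\ 0 < l %/ k <= q %/ k.
  case/andP=> l1 /eqP lk; have kl : k %| l by rewrite -lk max_pdiv_dvd.
  by rewrite divnK // divn_gt0 // dvdn_leq ?(ltnW l1) // leq_div2r // ltnW.
move=> /quo_spec[nE nb] /quo_spec[mE mb] /(congr1 val); rewrite /= !inordK; last 2 first.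
- by lia.
- by lia.
by move=> nm; apply: val_inj; rewrite /= nE mE; congr (_ * k); lia.
Qed.

(** A member is determined by its exponents at the primes up to [y], each below [K] because the
    member is below [2 ^ K]. Exponents are recorded at all of [0..y], prime or not, which avoids
    counting primes. *)
Lemma card_layer_smooth k y K : q <= 2 ^ K -> k <= y -> #|layer k| <= K ^ y.+1.
Proof.
move=> qK ky; have [-> | [n0]] := set_0Vmem (layer k); first by rewrite cards0.
rewrite inE => /andP[n01 _].
have K0 : 0 < K.
  by case: K qK => // q1; have := ltn_ord n0; move: n01 q1; rewrite expn0; lia.
pose f (n : 'I_q) := [ffun p : 'I_y.+1 => inord (logn p n) : 'I_K.-1.+1].
suff: #|layer k| <= #|{ffun 'I_y.+1 -> 'I_K.-1.+1}|.
  by rewrite card_ffun !card_ord prednK.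
apply: (@leq_card_in _ _ f) => n m; rewrite !inE.
move=> /andP[n1 /eqP nk] /andP[m1 /eqP mk] /ffunP fnm.
apply/val_inj/eqn_from_log => [||p]; try exact: ltnW.
have [py | py] := leqP p y; last by rewrite !logn_gt_max_pdiv ?nk ?mk //; lia.
have log_lt (l : 'I_q) : 1 < l -> logn p l < K.
  move=> l1; have [p_pr | pN] := boolP (prime p); last by rewrite lognE (negbTE pN).
  rewrite -(ltn_exp2l _ _ (isT : 1 < 2)); apply: leq_trans qK.
  apply: leq_ltn_trans (ltn_ord l); apply: leq_trans (_ : p ^ logn p l <= _).
    by case: (logn p l) => // e; rewrite leq_exp2r ?prime_gt1.
  by rewrite dvdn_leq ?(ltnW l1) // pfactor_dvdnn.
have := congr1 val (fnm (Ordinal (py : p < y.+1))).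
by rewrite !ffunE /= !inordK // prednK ?log_lt.
Qed.

Lemma card_layer_log k (y := trunc_log 2 (trunc_log 2 q)) :
  6 <= y -> #|layer k| * y <= q.
Proof.
move=> y6; have [ky | ky] := ltnP y k.
  by apply: leq_trans (card_layer_mul k); rewrite leq_mul2l ltnW ?orbT.
pose K := trunc_log 2 q; have yE : y = trunc_log 2 K by [].
have K0 : 0 < K by rewrite lt0n; apply/eqP => K0; move: y6; rewrite yE K0 trunc_log0.
have q0 : 0 < q by rewrite lt0n; apply/eqP => q0; move: K0; rewrite /K q0 trunc_log0.
have qlt : q <= 2 ^ K.+1 by rewrite ltnW ?trunc_log_ltn.
have Klt : K.+1 <= 2 ^ y.+1 by rewrite yE trunc_log_ltn.
apply: leq_trans (trunc_logP (isT : 1 < 2) q0); rewrite -/K.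
(* The chain is [(K+1)^(y+1) * 2^y <= 2^((y+1)^2 + y) <= 2^(2^y) <= 2^K <= q]. *)
apply: leq_trans (leq_mul (card_layer_smooth qlt ky) (ltnW (ltn_expl y (isT : 1 < 2)))) _.
apply: (@leq_trans ((2 ^ y.+1) ^ y.+1 * 2 ^ y)).
  by rewrite leq_mul2r leq_exp2r // Klt orbT.
rewrite -expnM -expnD leq_exp2l //.
by apply: leq_trans (square_le_exp2 y6) (trunc_logP _ _).
Qed.

End Layers.

(** * Recursive bounds for the number of vectors avoiding [x0] on successive layers *)

Section Counting.
Variables (q : nat) (x0 : 'F_q).
Hypotheses (q_pr : prime q) (x0N0 : (x0 != 0)%R).

Definition exponent n (i : 'I_(dim_q q)) : 'F_q :=
  (logn (nth 0%N (primes_below q) i) n)%:R%R.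

Lemma LformE n v : Lform n v = linear_form (exponent n) v.
Proof. by []. Qed.

(** The exponents in a number below [q] are themselves below [q], so by this lemma reducing them
    modulo [q] loses nothing. *)
Lemma natr_Fp_inj m n : m < q -> n < q -> (m%:R = n%:R :> 'F_q)%R -> m = n.
Proof.
by move=> mq nq /(congr1 val) /=; rewrite !val_Fp_nat // !modn_small.
Qed.

Lemma prime_index p : prime p -> p < q ->
  exists i : 'I_(dim_q q), nth 0%N (primes_below q) i = p.
Proof.
move=> p_pr pq; have p_in : p \in primes_below q.
  by rewrite mem_filter p_pr mem_iota.
have pi : index p (primes_below q) < dim_q q by rewrite index_mem.
by exists (Ordinal pi); rewrite /= nth_index.
Qed.

Lemma exponent_neq0 n i : 0 < n < q ->
  (exponent n i != 0)%R = (0 < logn (nth 0%N (primes_below q) i) n).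
Proof.
case/andP=> n0 nq; rewrite lt0n; congr (~~ _).
apply/eqP/eqP => [|e]; last by rewrite /exponent e.
by move/(@natr_Fp_inj _ 0); apply; rewrite ?prime_gt0 // (ltn_trans (ltn_logl _ n0)).
Qed.

Lemma exponent_inj n m : 0 < n < q -> 0 < m < q -> n != m ->
  exists i, exponent n i != exponent m i.
Proof.
move=> /andP[n0 nq] /andP[m0 mq] nm; apply/existsP; apply: contraNT nm.
move=> /existsPn enm; apply/eqP/eqn_from_log => // p.
have [p_pr | pN] := boolP (prime p); last by rewrite (lognE p n) (lognE p m) (negbTE pN).
have [pq | qp] := ltnP p q; last by rewrite !ltn_log0 // (leq_trans _ qp).
have [i ip] := prime_index p_pr pq.
have /negPn/eqP := enm i; rewrite /exponent ip; apply: natr_Fp_inj.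
  exact: ltn_trans (ltn_logl _ n0) nq.
exact: ltn_trans (ltn_logl _ m0) mq.
Qed.

Definition hit (n : 'I_q) : {set 'rV['F_q]_(dim_q q)} := [set v | Lform n v == x0].

Definition avoid k : {set 'rV['F_q]_(dim_q q)} :=
  [set v | [forall n in smooth_below q k, v \notin hit n]].

Lemma avoidS k :
  avoid k.+1 = [set v in avoid k | [forall n in layer q k, v \notin hit n]].
Proof.
apply/setP => v; rewrite !inE; apply/forall_inP/andP => [vk | [/forall_inP vk /forall_inP vl] n].
  split; apply/forall_inP => n; rewrite inE => /andP[n1 nk]; apply: vk.
    by rewrite inE n1 ltnW.
  by rewrite inE n1 (eqP nk) /=.
rewrite inE ltnS (leq_eqVlt (max_pdiv n)) andb_orr => /orP[nk | nk]; last by apply: vk; rewrite inE.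
by apply: vl; rewrite inE.
Qed.

Lemma card_avoid0 : #|avoid 0| = q ^ dim_q q.
Proof.
rewrite (_ : avoid 0 = setT) ?cardsT ?card_mx ?card_Fp ?mul1n //.
by apply/setP => v; rewrite !inE; apply/forall_inP => n; rewrite inE ltn0 andbF.
Qed.

(** The only number tested by [Ncount] and omitted from [avoid q] is 1, whose form is identically 0
    and so never equals [x0]. *)
Lemma card_avoid_full : #|avoid q| = Ncount x0.
Proof.
apply: eq_card => v; rewrite !inE.
apply/forall_inP/forallP => vq n.
  apply/implyP => n0; have [n1 | n1] := ltnP 1 n.
    by have := vq n; rewrite !inE n1 (leq_ltn_trans (max_pdiv_leq n0)) //; apply.
  have -> : n = 1 :> nat by lia.
  rewrite LformE /linear_form big1 1?eq_sym // => i _.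
  by rewrite /exponent logn1 mul0r.
rewrite !inE => /andP[n1 _].
by have := vq n; rewrite (ltnW n1).
Qed.

Lemma card_avoid_hit k n : n \in layer q k -> #|avoid k :&: hit n| * q = #|avoid k|.
Proof.
rewrite inE => /andP[n1 /eqP nk].
have nb : 0 < n < q by rewrite (ltnW n1) ltn_ord.
have [j jk] : exists j : 'I_(dim_q q), nth 0 (primes_below q) j = k.
  apply: prime_index; rewrite -nk ?max_pdiv_prime //.
  by apply: leq_ltn_trans (ltn_ord n); rewrite max_pdiv_leq // ltnW.
have aj : (exponent n j != 0)%R by rewrite exponent_neq0 // jk -nk logn_max_pdiv_gt0.
rewrite -(card_linear_form_fiber x0 aj (E := avoid k)) ?card_Fp //.
  by congr (_ * _); apply: eq_card => v; rewrite !inE.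
(* [avoid k] is stable along coordinate [j]: the prime [k] there exceeds every prime factor of the
   [m] concerned. *)
move=> v t; rewrite !inE => /forall_inP vk; apply/forall_inP => m mk.
have := vk m mk; rewrite !inE !LformE linear_form_translate.
move: mk; rewrite inE => /andP[m1 mk].
by rewrite /exponent jk logn_gt_max_pdiv // mulr0 addr0.
Qed.

Lemma card_hit2 k n m : n \in layer q k -> m \in layer q k -> m != n ->
  #|hit n :&: hit m| * q ^ 2 <= q ^ dim_q q.
Proof.
rewrite !inE => /andP[n1 /eqP nk] /andP[m1 /eqP mk] nm.
have nb : 0 < n < q by rewrite (ltnW n1) ltn_ord.
have mb : 0 < m < q by rewrite (ltnW m1) ltn_ord.
have [j jk] : exists j : 'I_(dim_q q), nth 0 (primes_below q) j = k.
  apply: prime_index; rewrite -nk ?max_pdiv_prime //.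
  by apply: leq_ltn_trans (ltn_ord n); rewrite max_pdiv_leq // ltnW.
have aj : (exponent n j != 0)%R by rewrite exponent_neq0 // jk -nk logn_max_pdiv_gt0.
have bj : (exponent m j != 0)%R by rewrite exponent_neq0 // jk -mk logn_max_pdiv_gt0.
have nm' : nat_of_ord n != m by rewrite eq_sym.
have := card_linear_form_fiber2 x0N0 aj bj (exponent_inj nb mb nm').
rewrite card_mx mul1n !card_Fp //; apply: leq_trans; rewrite leq_mul2r.
by apply/orP; right; apply/subset_leq_card/subsetP => v; rewrite !inE.
Qed.

Lemma card_avoidS_ge k :
  q * #|avoid k| <= q * #|avoid k.+1| + #|layer q k| * #|avoid k|.
Proof.
have := union_bound (avoid k) (layer q k) hit; rewrite -avoidS.
rewrite -(leq_pmul2l (prime_gt0 q_pr)) mulnDr => /leq_trans; apply.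
rewrite leq_add2l mulnC big_distrl /= -sum_nat_const; apply: leq_sum => n nk.
by rewrite card_avoid_hit.
Qed.

(** Divided by [q ^ (dim_q q + 2)], this reads [P' <= P (1 - t) + t^2], where [t] is the layer size
    over [q] and [P], [P'] are the consecutive densities. *)
Lemma card_avoidS_le k :
  q ^ 2 * #|avoid k.+1| + q * (#|layer q k| * #|avoid k|)
    <= q ^ 2 * #|avoid k| + #|layer q k| ^ 2 * q ^ dim_q q.
Proof.
have := bonferroni_bound (avoid k) (layer q k) hit; rewrite -avoidS.
rewrite -(leq_pmul2l (_ : 0 < q ^ 2)) ?expn_gt0 ?prime_gt0 // !mulnDr.
have -> : q ^ 2 * (\sum_(n in layer q k) #|avoid k :&: hit n|)
          = q * (#|layer q k| * #|avoid k|).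
  rewrite expnS expn1 -mulnA; congr (_ * _); rewrite mulnC big_distrl /= -sum_nat_const.
  by apply: eq_bigr => n nk; rewrite card_avoid_hit.
move/leq_trans; apply; rewrite leq_add2l big_distrr /=.
rewrite expnS expn1 -mulnA -sum_nat_const; apply: leq_sum => n nk.
rewrite big_distrr /=; apply: (@leq_trans (\sum_(m in layer q k | m != n) q ^ dim_q q)).
  by apply: leq_sum => m /andP[mk mn]; rewrite mulnC (card_hit2 nk).
rewrite big_mkcondr /= -sum_nat_const.
by apply: leq_sum => m _; case: ifP.
Qed.

End Counting.

(** * Real estimates and the passage to the limit [1/e] *)

Local Open Scope R_scope.

Lemma INR_expn m n : INR (m ^ n) = INR m ^ n.
Proof. by elim: n => [|n IH]; rewrite ?expn0 // expnS mult_INR IH. Qed.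

Lemma INR_leq m n : (m <= n)%N -> INR m <= INR n.
Proof. by move/leP; apply: le_INR. Qed.

Lemma trunc_log2_le n : (trunc_log 2 n <= n)%N.
Proof.
case: n => // n; apply: leq_trans (trunc_logP (isT : (1 < 2)%N) (isT : (0 < n.+1)%N)).
exact: ltnW (ltn_expl _ (isT : (1 < 2)%N)).
Qed.

Lemma exp_neg_bounds t : 0 <= t -> 1 - t <= exp (- t) <= 1 - t + t * t.
Proof.
move=> t0; split; first by have := exp_ineq1_le (- t); lra.
have et := exp_ineq1_le t; have e0 := exp_pos (- t).
have inv : exp (- t) * exp t = 1 by rewrite -exp_plus Rplus_opp_l exp_0.
(* After multiplication, the left side is at most [exp (- t) * exp t = 1] and the right side is
   [1 + t^3]. *)
apply: (Rmult_le_reg_r (1 + t)); first lra.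
by nra.
Qed.

Lemma exp_neg_le1 t : 0 <= t -> exp (- t) <= 1.
Proof.
move=> t0; have := exp_ineq1_le t; have := exp_pos (- t).
by have : exp (- t) * exp t = 1 by [rewrite -exp_plus Rplus_opp_l exp_0]; nra.
Qed.

(** Both [P'] and [exp (- (s + t))] exceed [1 - t] times their predecessors by an amount in
    [[0, t^2]]. The old error is thus contracted by [1 - t], and at most [t^2] is added. *)
Lemma exp_step P P' s t : 0 <= s -> 0 <= t <= 1 ->
    P * (1 - t) <= P' <= P * (1 - t) + t * t ->
  Rabs (P' - exp (- (s + t))) <= Rabs (P - exp (- s)) + t * t.
Proof.
move=> s0 [t0 t1] [P1 P2]; rewrite Ropp_plus_distr exp_plus.
have [e1 e2] := exp_neg_bounds t0.
have E0 := exp_pos (- s); have E1 := exp_neg_le1 s0.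
set E := exp (- s) in E0 E1 *; set f := exp (- t) in e1 e2 *.
have h1 : 0 <= E * (f - (1 - t)) <= t * t by nra.
have := Rle_abs (P - E); have := Rle_abs (- (P - E)); rewrite Rabs_Ropp => a1 a2.
by apply: Rabs_le; split; nra.
Qed.

Lemma ln_le_pow2 x n : 0 < x -> x <= 2 ^ n -> ln x <= INR n.
Proof.
move=> x0 xn; rewrite -(ln_exp (INR n)).
have : x <= exp (INR n).
  apply: Rle_trans xn _; elim: n => [|n IH]; first by rewrite exp_0 /=; lra.
  rewrite S_INR exp_plus /=; have := exp_ineq1_le 1; have := exp_pos (INR n).
  by nra.
by case=> [/(ln_increasing _ _ x0)/Rlt_le | ->] //; apply: Rle_refl.
Qed.

(** Natural logarithms are bounded by binary ones; rounding down costs 1, giving [y + 1]. The factor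
    2 absorbs this as well as the floor value 2 of [logR]. *)
Lemma log2R_le q (y := trunc_log 2 (trunc_log 2 q)) : (0 < y)%N ->
  log2R (INR q) <= 2 * INR y.
Proof.
move=> y0; have y1 : 1 <= INR y by apply: (INR_leq (m := 1)).
pose K := trunc_log 2 q.
have K0 : (0 < K)%N.
  by rewrite lt0n; apply/eqP => K0; move: y0; rewrite /y -/K K0 trunc_log0.
have q0 : (0 < q)%N.
  by rewrite lt0n; apply/eqP => q0; move: K0; rewrite /K q0 trunc_log0.
have lnq : ln (INR q) <= INR K.+1.
  apply: ln_le_pow2; first exact/lt_0_INR/ltP.
  by rewrite -(INR_expn 2); apply: INR_leq; rewrite ltnW // trunc_log_ltn.
have K2 : 2 <= INR K.+1 by apply: (INR_leq (m := 2)).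
have logq : logR (INR q) <= INR K.+1 by apply: Rmax_lub.
have logq2 : 2 <= logR (INR q) by apply: Rmax_r.
apply: Rmax_lub; last lra.
suff : ln (logR (INR q)) <= INR y.+1 by rewrite S_INR; lra.
apply: ln_le_pow2; first lra.
apply: Rle_trans logq _; rewrite -(INR_expn 2); apply: INR_leq.
exact: trunc_log_ltn.
Qed.

(** By induction on [k]: a layer of relative size [t] adds an error [t^2 <= t / y], so the errors
    add up to the total relative size over [y]. *)
Lemma avoid_density q (x0 : 'F_q) (y := trunc_log 2 (trunc_log 2 q)) k :
    prime q -> x0 != GRing.zero -> (6 <= y)%N ->
  Rabs (INR #|avoid x0 k| / INR q ^ dim_q q - exp (- (INR #|smooth_below q k| / INR q)))
    <= INR #|smooth_below q k| / (INR q * INR y).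
Proof.
move=> q_pr x0N0 y6.
have q0 : 0 < INR q by apply/lt_0_INR/ltP/prime_gt0.
have y1 : 6 <= INR y by have := INR_leq y6; rewrite /=; lra.
have qd0 : 0 < INR q ^ dim_q q by apply: pow_lt.
elim: k => [|k IH].
  have -> : smooth_below q 0 = finset.set0.
    by apply/setP => n; rewrite !inE andbF.
  rewrite cards0 card_avoid0 // INR_expn /Rdiv !Rmult_0_l Ropp_0 exp_0.
  by rewrite Rinv_r ?Rminus_diag ?Rabs_R0; lra.
rewrite card_smooth_belowS plus_INR.
have := INR_leq (card_avoidS_ge x0 q_pr k).
have := INR_leq (card_avoidS_le q_pr x0N0 k).
have := INR_leq (card_layer_log k y6); rewrite -/y.
rewrite !(plus_INR, mult_INR, INR_expn).
set a := INR #|layer q k|; set s := INR #|smooth_below q k| in IH *.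
set S := INR #|avoid x0 k| in IH *; set S' := INR #|avoid x0 k.+1|.
set D := INR q ^ dim_q q in qd0 IH *.
have a0 : 0 <= a by apply: pos_INR.
have s0 : 0 <= s by apply: pos_INR.
move=> ay Sle Sge.
pose t := a / INR q.
have aE : a = t * INR q by rewrite /t; field; lra.
have t0 : 0 <= t by apply: Rle_mult_inv_pos.
have ty : t * INR y <= 1 by rewrite aE in ay; nra.
have SE : S = S / D * D by field; lra.
have SE' : S' = S' / D * D by field; lra.
have -> : (s + a) / INR q = s / INR q + t by rewrite /t; field; lra.
have -> : (s + a) / (INR q * INR y) = s / (INR q * INR y) + t * / INR y.
  by rewrite /t; field; lra.
have tt : t * t <= t * / INR y.
  apply: Rmult_le_compat_l => //; apply: (Rmult_le_reg_r (INR y)); first lra.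
  by rewrite Rinv_l; lra.
apply: Rle_trans (exp_step (P := S / D) _ _ _) _; last lra.
- exact: Rle_mult_inv_pos.
- by nra.
set P := S / D in SE *; set P' := S' / D in SE' *.
have qD : 0 < INR q * D by nra.
split.
  apply: (Rmult_le_reg_r (INR q * D)) => //.
  by rewrite SE SE' aE in Sge; lra.
apply: (Rmult_le_reg_r (INR q * (INR q * D))); first by nra.
rewrite SE SE' aE /= in Sle.
by lra.
Qed.

Delimit Scope R_scope with R.

Theorem theorem1p1 :
  exists C : R, exists Q0 : nat,
    forall q : nat, prime q -> (Q0 <= q)%N ->
    forall x0 : 'F_q, x0 != GRing.zero ->
      (Rabs (cq x0 - exp (-1)) <= C / log2R (INR q))%R.
Proof.
(* The threshold makes [y >= 6]. The density error is at most [1/y], replacing [(q - 2)/q] by 1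
   costs at most [2/q <= 2/y], and [1/y <= 2 / log2R (INR q)]; hence [6 = 3 * 2]. *)
exists 6, (2 ^ (2 ^ 6))%N => q q_pr q_large x0 x0N0.
pose y := trunc_log 2 (trunc_log 2 q).
have {q_large} y6 : (6 <= y)%N by do 2 apply: trunc_log_max => //.
have := avoid_density q q_pr x0N0 y6.
rewrite card_avoid_full // card_smooth_below_full -/y -/(cq x0).
have yq : (y <= q)%N by exact: leq_trans (trunc_log2_le _) (trunc_log2_le _).
rewrite minus_INR; last exact/leP/prime_gt1.
have {yq} yq := INR_leq yq.
have y1 : 6 <= INR y by have := INR_leq y6; rewrite /=; lra.
have logy : log2R (INR q) <= 2 * INR y by apply: log2R_le; apply: leq_trans y6.
have log2 : 2 <= log2R (INR q) by apply: Rmax_r.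
set u := 2 / INR q.
have u0 : 0 <= u by apply: Rle_mult_inv_pos; lra.
have uy : u <= 2 / INR y.
  by apply: Rmult_le_compat_l; [lra | apply: Rinv_le_contravar; lra].
have u1 : u <= 1.
  apply: Rle_trans uy _; apply: (Rmult_le_reg_r (INR y)); first lra.
  by rewrite /Rdiv Rmult_assoc Rinv_l; lra.
have -> : (INR q - INR 2) / INR q = 1 - u by rewrite /u /=; field; lra.
have -> : (INR q - INR 2) / (INR q * INR y) = (1 - u) / INR y.
  by rewrite /u /=; field; lra.
have y0 : 0 < / INR y by apply: Rinv_0_lt_compat; lra.
have -> : exp (- 1) = exp (- (1 - u)) * exp (- u) by rewrite -exp_plus; congr exp; lra.
have [eu _] := exp_neg_bounds u0; have eu1 := exp_neg_le1 u0.
have e0 := exp_pos (- (1 - u)); have e1 : exp (- (1 - u)) <= 1 by apply: exp_neg_le1; lra.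
set E := exp (- (1 - u)) in e0 e1 *; set f := exp (- u) in eu eu1 *.
move=> dens.
have Ef : Rabs (E - E * f) <= u by apply: Rabs_le; nra.
have -> : cq x0 - E * f = (cq x0 - E) + (E - E * f) by lra.
apply: Rle_trans (Rabs_triang _ _) _.
apply: (@Rle_trans _ (3 / INR y)); first by rewrite /Rdiv in dens uy *; nra.
have -> : 3 / INR y = 6 / (2 * INR y) by field; lra.
by apply: Rmult_le_compat_l; [lra | apply: Rinv_le_contravar; lra].
Qed.
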